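(* Let $0<\alpha<1$, $\gamma=1/\alpha$, let $s\ge0$ be an integer and let $$R_{(s)}=\frac{\sum_{k=s+1}^\infty\Gamma_k^{-1/\alpha}}{\Gamma_{s+1}^{-1/\alpha}}.$$ For every integer $k\ge1$, $$E\left\{R_{(s)}^k\right\}=1+\sum_{i=1}^k\binom ki\sum_{j=1}^i\frac{(s+j)!}{s!}\,C_{i,j}(\gamma),$$ where $$C_{i,j}(\gamma)=\sum\frac{i!}{m_1!m_2!\cdots m_{i-j+1}!}\prod_{l=1}^{i-j+1}\left(\frac1{l!\,(l\gamma-1)}\right)^{m_l},$$ the sum being over all non-negative integers $m_1,\ldots,m_{i-j+1}$ with $m_1+\cdots+m_{i-j+1}=j$ and $1m_1+2m_2+\cdots+(i-j+1)m_{i-j+1}=i$.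
   Context: $E_1,E_2,\ldots$ are i.i.d. exponential random variables with unit mean and $\Gamma_k=E_1+\cdots+E_k$. For $0<\alpha<1$ the series $\sum_k\Gamma_k^{-1/\alpha}$ converges almost surely. *)

(* Defs.v *)
From HB Require Import structures.
From mathcomp Require Import all_boot all_order all_algebra.
From mathcomp Require Import all_classical all_reals all_analysis.

Set Implicit Arguments.
Unset Strict Implicit.
Unset Printing Implicit Defensive.

Import Order.TTheory GRing.Theory Num.Theory.
Import numFieldNormedType.Exports.

Local Open Scope classical_set_scope.
Local Open Scope ring_scope.

Definition mutually_independent (d : measure_display) (T : measurableType d)
    (R : realType) (P : probability T R) (X : nat -> {RV P >-> R}) : Prop :=
  forall (I : seq nat) (A : nat -> set R), uniq I ->
    (forall i, i \in I -> measurable (A i)) ->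
    P (\bigcap_(i in [set` I]) (X i @^-1` A i)) =
    (\prod_(i <- I) P (X i @^-1` A i))%E.

(* Equality of laws is required on measurable sets only: both sides are total
   functions of arbitrary sets. *)
Definition iid_exponential1 (d : measure_display) (T : measurableType d)
    (R : realType) (P : probability T R) (E : nat -> {RV P >-> R}) : Prop :=
  mutually_independent E /\
  forall (i : nat) (A : set R), measurable A ->
    distribution P (E i) A = exponential_prob (1 : R) A.

(* The sequence E is indexed from 0, so that E i stands for $E_{i+1}$ and
   Gamma E k for $E_1 + \dots + E_k$. *)
Definition Gamma (T : Type) (R : realType) (E : nat -> T -> R) (k : nat)
    (w : T) : R := \sum_(i < k) E i w.

(* On the null event where the series diverges, limn takes a default value. *)
Definition ratioR (T : Type) (R : realType) (E : nat -> T -> R) (alpha : R)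
    (s : nat) (w : T) : R :=
  limn (fun n => \sum_(s.+1 <= k < n) Gamma E k w `^ (- (1 / alpha))) /
  (Gamma E s.+1 w `^ (- (1 / alpha))).

(* The index l : 'I_(i - j).+1 stands for $l + 1 \in \{1, \dots, i-j+1\}$.
   Bounding the values of m by j loses no tuple, since they sum to j. *)
Definition Ccoef (R : realType) (i j : nat) (gamma : R) : R :=
  \sum_(m : {ffun 'I_(i - j).+1 -> 'I_j.+1} |
        (\sum_(l < (i - j).+1) m l == j)%N &&
        (\sum_(l < (i - j).+1) l.+1 * m l == i)%N)
    (i`!%:R / (\prod_(l < (i - j).+1) (m l)`!)%N%:R *
     \prod_(l < (i - j).+1)
        (1 / (l.+1`!%:R * (l.+1%:R * gamma - 1))) ^+ m l).

(* Main.v *)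
(* Since Gamma_(s+1)/Gamma_(s+2) is independent of the sequence
   (Gamma_(s+2), Gamma_(s+3), ...) and has moments (s+1)/(s+1+p), expanding
   R_(s) = 1 + (Gamma_(s+1)/Gamma_(s+2))^gamma R_(s+1) binomially gives
     E R_(s)^k = sum_i 'C(k,i) (s+1)/(s+1+i gamma) E R_(s+1)^i.
   The claimed value F_k(s) satisfies the same recurrence: the C_(i,j) are the
   partial Bell polynomials at 1/(l gamma - 1), with generating functions
   phi^j/j! where gamma t phi' - phi = e^t - 1.  The moments of the truncated
   sums follow the recurrence from the constant 1 <= F_k(s), so they stay below
   F_k(s), and the defect of their limit is a nonnegative solution, of polynomial
   growth at most s^k, of the homogeneous recurrence, hence 0 because k gamma > k.  Monotone
   convergence concludes. *)
From HB Require Import structures.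
Require Import Defs.
From mathcomp Require Import all_boot all_order all_algebra.
From mathcomp Require Import all_classical all_reals all_analysis.
From mathcomp Require Import measurable_realfun ring.

Import Order.TTheory GRing.Theory Num.Theory.
Import numFieldNormedType.Exports.

Local Open Scope classical_set_scope.
Local Open Scope ring_scope.

(** * Partial Bell polynomials and the moment recurrence *)

Section bell.
Context {R : realType} (gamma : R) (gamma1 : 1 < gamma).

Lemma factr_neq0 (n : nat) : n`!%:R != 0 :> R.
Proof. by rewrite pnatr_eq0 -lt0n fact_gt0. Qed.

Definition weight (l : nat) : R := 1 / (l.+1`!%:R * (l.+1%:R * gamma - 1)).

Lemma weight_denom_gt0 (l : nat) : 0 < l.+1%:R * gamma - 1.
Proof. by rewrite subr_gt0 (lt_le_trans gamma1)// ler_peMl ?ler1n// ltW// (lt_trans ltr01). Qed.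

Lemma weight_ge0 (l : nat) : 0 <= weight l.
Proof. by rewrite divr_ge0// mulr_ge0// ltW// weight_denom_gt0. Qed.

(** Exponential generating function of the numbers [1 / (l * gamma - 1)], cut after degree [L] so as
    to be a polynomial. *)
Definition phi (L : nat) : {poly R} := \sum_(l < L) weight l *: 'X^(l.+1).

(** The partial Bell polynomial, read off as [i!] times the coefficient of [t^i] in [phi^j / j!]. *)
Definition bellc (i j : nat) : R := i`!%:R / j`!%:R * (phi i.+1 ^+ j)`_i.

(** Since ['X] divides [phi], the coefficient of degree [i] in the [j]-th power involves [phi / 'X]
    only up to degree [i - j], where both truncations agree. *)
Lemma coef_phiX (L L' i j : nat) : (i - j < L)%N -> (i - j < L')%N ->
  (phi L ^+ j)`_i = (phi L' ^+ j)`_i.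
Proof.
wlog LL' : L L' / (L <= L')%N => [wl iL iL'|iL iL'].
  by have [/wl->//|/ltnW/wl->] := leqP L L'.
pose psi L : {poly R} := \sum_(l < L) weight l *: 'X^l.
have phiE M : phi M = psi M * 'X.
  rewrite /psi mulr_suml; apply: eq_bigr => l _.
  by rewrite -scalerAl exprSr.
rewrite !phiE !exprMn !coefMXn; case: ltnP => // ji.
have [r ->] : exists r, psi L' = psi L + 'X^L * r.
  exists (\sum_(l < L' - L) weight (L + l) *: 'X^l).
  rewrite /psi -(subnKC LL') big_split_ord/= addKn; congr (_ + _).
  rewrite mulr_sumr; apply: eq_bigr => l _.
  by rewrite -scalerAr exprD.
apply/eqP; rewrite eq_sym -subr_eq0 -coefB subrXX addrAC subrr add0r -mulrA.
by rewrite coefXnM iL.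
Qed.

Lemma bellcE (L i j : nat) : (i - j < L)%N ->
  bellc i j = i`!%:R / j`!%:R * (phi L ^+ j)`_i.
Proof. by move=> iL; rewrite /bellc (coef_phiX _ L)// ltnS leq_subr. Qed.

(** In divided powers [x^j / j!] the binomial theorem loses its binomial coefficients. *)
Lemma phiS_divided_power (L j : nat) : j`!%:R^-1 *: phi L.+1 ^+ j =
  \sum_(m < j.+1) ((j - m)`!%:R^-1 *: phi L ^+ (j - m)) *
    (m`!%:R^-1 *: (weight L *: 'X^(L.+1)) ^+ m).
Proof.
rewrite {1}/phi big_ord_recr/= -/(phi L) exprDn scaler_sumr.
apply: eq_bigr => m _; rewrite -scalerAr -scalerAl scalerA -[X in _ *: X]scaler_nat scalerA.
have mj : (m <= j)%N by rewrite -ltnS.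
congr (_ *: _); rewrite -(bin_fact mj) !natrM.
have f0 := factr_neq0.
have b0 : 'C(j, m)%:R != 0 :> R by rewrite pnatr_eq0 -lt0n bin_gt0.
by field; rewrite !f0 b0.
Qed.

(** The outer variable marks the exponent: each factor is a truncated exponential, and a product of
    exponentials is the exponential of the sum [phi L]. The cut at [J] leaves the coefficients up to
    degree [J] intact. *)
Lemma coef_prod_divided_power (J L j : nat) : (j <= J)%N ->
  (\prod_(l < L) \sum_(m < J.+1)
     (m`!%:R^-1 *: (weight l *: 'X^(l.+1)) ^+ m) *: 'X^m : {poly {poly R}})`_j =
  j`!%:R^-1 *: phi L ^+ j.
Proof.
elim: L j => [|L IH] j jJ.
  rewrite big_ord0 coef1 /phi big_ord0 expr0n; case: j jJ => [|j] _ /=.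
    by rewrite fact0 invr1 scale1r.
  by rewrite scaler0.
rewrite big_ord_recr/= phiS_divided_power coefMr.
apply: eq_bigr => m _; rewrite IH; last by rewrite (leq_trans (leq_subr _ _)).
congr (_ * _); rewrite coef_sum.
have mJ : (m < J.+1)%N by rewrite ltnS (leq_trans _ jJ)// -ltnS.
rewrite (bigD1 (Ordinal mJ))//= coefZ coefXn eqxx mulr1 big1 ?addr0// => i im.
by rewrite coefZ coefXn -(inj_eq val_inj)/= eq_sym in im *; rewrite (negPf im) mulr0.
Qed.

Lemma multinomial_phi (J L j : nat) : (j <= J)%N -> j`!%:R^-1 *: phi L ^+ j =
  \sum_(m : {ffun 'I_L -> 'I_J.+1} | (\sum_(l < L) m l == j)%N)
    \prod_(l < L) ((m l)`!%:R^-1 *: (weight l *: 'X^(l.+1)) ^+ m l).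
Proof.
move=> jJ; rewrite -(coef_prod_divided_power _ _ _ jJ) bigA_distr_bigA coef_sum.
rewrite [RHS]big_mkcond; apply: eq_bigr => f _.
rewrite scaler_prod prodrXr coefZ coefXn eq_sym.
by case: eqP => _; rewrite ?mulr1 ?mulr0.
Qed.

(** The constraint that the [m l] sum to [j] comes from the multinomial expansion, the weighted
    constraint from taking the coefficient of degree [i]. *)
Lemma Ccoef_bellc (i j : nat) : (j <= i)%N -> Ccoef i j gamma = bellc i j.
Proof.
move=> ji; rewrite (bellcE (i - j).+1)// -mulrA -coefZ (multinomial_phi j)//.
rewrite coef_sum mulr_sumr /Ccoef big_mkcondr/=; apply: eq_bigr => m _.
under [in RHS]eq_bigr do rewrite exprZn scalerA -exprM.
rewrite scaler_prod prodrXr coefZ coefXn eq_sym.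
case: eqP => _; last by rewrite !mulr0.
rewrite mulr1 big_split/= natr_prod prodfV -mulrA.
by congr (_ * (_ * _)).
Qed.

Lemma bellc_ge0 (i j : nat) : (j <= i)%N -> 0 <= bellc i j.
Proof.
move=> /Ccoef_bellc <-; apply: sumr_ge0 => m _.
by rewrite mulr_ge0 ?divr_ge0// prodr_ge0// => l _; rewrite exprn_ge0// weight_ge0.
Qed.

Lemma bellc_gt (i j : nat) : (i < j)%N -> bellc i j = 0.
Proof.
(* As [i - j] is 0, a single monomial suffices, and its [j]-th power has degree [j > i]. *)
move=> ij; rewrite (bellcE 1) ?(eqP (ltnW ij))//.
by rewrite /phi big_ord1 expr1 exprZn coefZ coefXn ltn_eqF// !mulr0.
Qed.

Lemma bellc0 (i : nat) : bellc i 0 = (i == 0)%:R.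
Proof.
by rewrite /bellc expr0 coef1; case: i => [|i]; rewrite ?mulr0//= mulr1 divff// factr_neq0.
Qed.

(* With phi the exponential generating function of the weights, this is
   (gamma t d/dt - (j + 1)) phi^(j+1)/(j+1)! = (e^t - 1) phi^j/j!. *)
Lemma bellc_rec (k j : nat) : (k%:R * gamma - j.+1%:R) * bellc k j.+1 =
  \sum_(i < k) 'C(k, i)%:R * bellc i j.
Proof.
pose L := k.+1; pose e : {poly R} := \sum_(l < L) (l.+1`!%:R)^-1 *: 'X^(l.+1).
(* The weights are made for this: their denominators [(l + 1) * gamma - 1] cancel and leave the
   truncation of [e^t - 1]. *)
have phiD : gamma *: (phi L)^`() * 'X - phi L = e.
  rewrite /phi raddf_sum/= scaler_sumr mulr_suml -sumrB; apply: eq_bigr => l _.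
  rewrite derivZ derivXn/= -scalerAl -scalerAl mulrnAl -exprSr -scaler_nat !scalerA.
  rewrite -scalerBl; congr (_ *: _); rewrite /weight.
  have f0 := factr_neq0 l.+1.
  have := weight_denom_gt0 l; rewrite lt0r => /andP[w0 _].
  by field; rewrite f0 nat1r.
have eE n : (n < L)%N -> e`_n = (n != 0)%:R / n`!%:R.
  move=> nL; rewrite coef_sum; case: n nL => [|n] nL.
    by rewrite mul0r big1// => l _; rewrite coefZ coefXn mulr0.
  rewrite (bigD1 (Ordinal (ltnW nL)))//= coefZ coefXn eqxx mulr1 mul1r big1 ?addr0//.
  move=> i; rewrite -(inj_eq val_inj)/= eq_sym => /negPf im.
  by rewrite coefZ coefXn eqSS im mulr0.
(* The identity [phiD] multiplied by [(j + 1) phi^j]. *)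
have /(congr1 (coefp k)) : gamma *: ((phi L ^+ j.+1)^`() * 'X) - phi L ^+ j.+1 *+ j.+1 =
    (phi L ^+ j * e) *+ j.+1.
  rewrite -phiD deriv_exp -[j.+1.-1]/j -!mul_polyC.
  move: (phi L) (phi L)^`() gamma%:P => p q g; rewrite exprS.
  by ring.
rewrite /= coefB coefZ coefMX !coefMn coef_deriv.
have -> : (if k == 0%N then 0 else (phi L ^+ j.+1)`_k.-1.+1 *+ k.-1.+1) =
    (phi L ^+ j.+1)`_k *+ k by case: (k) => //; rewrite mulr0n.
rewrite coefM big_ord_recr/= subnn eE// eqxx mul0r mulr0 addr0 => H.
transitivity (k`!%:R / j.+1`!%:R *
    (\sum_(i < k) (phi L ^+ j)`_i * e`_(k - i) *+ j.+1)).
  rewrite sumrMnl -H (bellcE L) ?ltnS ?leq_subr// -mulr_natr -[X in _ - X]mulr_natr.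
  by ring.
rewrite mulr_sumr; apply: eq_bigr => i _.
have ik := ltn_ord i.
rewrite (bellcE L); last by rewrite (leq_ltn_trans (leq_subr _ _))// (ltn_trans ik).
rewrite eE ?ltnS ?leq_subr// -lt0n subn_gt0 ik -(bin_fact (ltnW ik)) factS !natrM.
rewrite -[X in _ * X = _]mulr_natr [true%:R]mulr1n.
have ? := factr_neq0 i; have ? := factr_neq0 j; have ? := factr_neq0 (k - i).
have ? : j.+1%:R != 0 :> R by rewrite pnatr_eq0.
by field; rewrite nat1r; apply/and3P.
Qed.

(** Claimed value of the [i]-th moment of [R_(s) - 1]; [moment] restores the 1 binomially. *)
Definition central_moment (i s : nat) : R :=
  \sum_(j < i.+1) ((s + j)%N`!%:R / s`!%:R) * bellc i j.

Definition moment (k s : nat) : R :=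
  \sum_(i < k.+1) 'C(k, i)%:R * central_moment i s.

Lemma central_moment_rec (k s : nat) :
  central_moment k s = s.+1%:R / (s.+1%:R + k%:R * gamma) * moment k s.+1.
Proof.
have s0 : 0 < s.+1%:R + k%:R * gamma.
  by rewrite ltr_pwDl// mulr_ge0// (le_trans ler01) ?ltW.
apply: (mulfI (lt0r_neq0 s0)); rewrite mulrA mulrCA divff ?lt0r_neq0// mulr1.
pose rf j : R := (s + j)%N`!%:R / s`!%:R.
have rfS j : s.+1%:R * ((s.+1 + j)%N`!%:R / s.+1`!%:R) = rf j.+1.
  rewrite /rf addSnnS factS natrM.
  have ? := factr_neq0 s; have ? : s.+1%:R != 0 :> R by rewrite pnatr_eq0.
  by field; apply/andP.
have rfD j : rf j.+1 = (s.+1 + j)%:R * rf j.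
  by rewrite /rf addnS factS natrM addSn mulrA.
(* Split [s + 1 + k gamma] as [(s + 1 + j) + (k gamma - j)]: the first part turns [rf j] into
   [rf j.+1], the second is the factor in [bellc_rec]. *)
transitivity (\sum_(j < k.+1) rf j.+1 * bellc k j +
              \sum_(j < k.+1) rf j * ((k%:R * gamma - j%:R) * bellc k j)).
  rewrite -big_split mulr_sumr/=; apply: eq_bigr => j _.
  by rewrite rfD -/(rf j) natrD; ring.
(* The first sum supplies the term [i = k]; the second, shifted by one in [j], supplies the terms
   [i < k] through [bellc_rec]. *)
transitivity (\sum_(j < k.+1) rf j.+1 * \sum_(i < k.+1) 'C(k, i)%:R * bellc i j).
  under [RHS]eq_bigr do rewrite big_ord_recr/= binn mul1r mulrDr.
  rewrite [RHS]big_split/= addrC; congr (_ + _).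
  rewrite big_ord_recl/= bellc0; case: (k) => [|n].
    by rewrite mul0r subr0 mul0r mulr0 add0r big_ord0 big_ord1 big_ord0 mulr0.
  rewrite !mulr0 add0r [RHS]big_ord_recr/= -bellc_rec bellc_gt// !mulr0 addr0.
  by apply: eq_bigr => j _; rewrite -bellc_rec.
rewrite /moment mulr_sumr.
under eq_bigr do rewrite mulr_sumr.
rewrite exchange_big/=; apply: eq_bigr => i _.
under eq_bigr do rewrite mulrCA.
rewrite -mulr_sumr mulrCA; congr (_ * _).
rewrite /central_moment mulr_sumr.
rewrite (big_ord_widen k.+1 (fun j => s.+1%:R * ((s.+1 + j)%N`!%:R / s.+1`!%:R * bellc i j)))//.
rewrite [RHS]big_mkcond/=; apply: eq_bigr => j _; rewrite mulrA rfS.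
by case: ltnP => // ij; rewrite bellc_gt// mulr0.
Qed.

Lemma moment_rec (k s : nat) : moment k s =
  \sum_(i < k.+1) 'C(k, i)%:R * (s.+1%:R / (s.+1%:R + i%:R * gamma) * moment i s.+1).
Proof. by apply: eq_bigr => i _; rewrite central_moment_rec. Qed.

Lemma central_moment_ge0 (k s : nat) : 0 <= central_moment k s.
Proof. by apply: sumr_ge0 => j _; rewrite mulr_ge0 ?bellc_ge0// -ltnS. Qed.

Lemma moment_ge1 (k s : nat) : 1 <= moment k s.
Proof.
rewrite /moment big_ord_recl/= bin0 mul1r {1}/central_moment big_ord1 addn0.
rewrite divff ?factr_neq0// bellc0 mul1r lerDl sumr_ge0// => i _.
by rewrite mulr_ge0// central_moment_ge0.
Qed.

(** Each rising factorial involved has at most [k] factors. This polynomial growth is what later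
    excludes nonzero solutions of the homogeneous recurrence. *)
Lemma moment_bound (k : nat) : exists B,
  forall s, moment k s <= B * ((s + k)%N`!%:R / s`!%:R).
Proof.
exists (\sum_(i < k.+1) 'C(k, i)%:R * \sum_(j < i.+1) bellc i j) => s.
rewrite mulr_suml; apply: ler_sum => i _; rewrite -mulrA ler_wpM2l//.
rewrite mulr_suml; apply: ler_sum => j _; rewrite mulrC ler_wpM2l ?bellc_ge0 -1?ltnS//.
rewrite ler_wpM2r ?invr_ge0// ler_nat.
have jk : (j <= k)%N by rewrite -ltnS (leq_trans (ltn_ord j)).
by rewrite leq_fact// leq_add2l.
Qed.

Lemma momentE (k s : nat) : moment k s = 1 + \sum_(1 <= i < k.+1) 'C(k, i)%:R *
  \sum_(1 <= j < i.+1) ((s + j)%N`!%:R / s`!%:R) * Ccoef i j gamma.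
Proof.
rewrite /moment -(big_mkord xpredT (fun i => 'C(k, i)%:R * central_moment i s)).
rewrite big_ltn// bin0 mul1r {1}/central_moment big_ord1 addn0.
rewrite divff ?factr_neq0// bellc0 mul1r; congr (_ + _).
rewrite big_nat [RHS]big_nat; apply: eq_bigr => i /andP[i0 _]; congr (_ * _).
rewrite /central_moment.
rewrite -(big_mkord xpredT (fun j => (s + j)%N`!%:R / s`!%:R * bellc i j)).
rewrite big_ltn// bellc0 gtn_eqF// mulr0 add0r.
by rewrite big_nat [RHS]big_nat; apply: eq_bigr => j /andP[_ ji]; rewrite Ccoef_bellc.
Qed.

(** The recurrence run [N] times from the constant 1; [truncated_ratio_moment] identifies the result
    as a moment of the ratio cut after [N + 1] terms. *)
Fixpoint partial_moment (N k s : nat) : R :=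
  if N is N'.+1 then
    \sum_(i < k.+1) 'C(k, i)%:R *
      (s.+1%:R / (s.+1%:R + i%:R * gamma) * partial_moment N' i s.+1)
  else 1.

Let coef_ge0 (i s : nat) : 0 <= s.+1%:R / (s.+1%:R + i%:R * gamma).
Proof. by rewrite divr_ge0// addr_ge0// mulr_ge0// ltW// (lt_trans ltr01). Qed.

Lemma partial_moment_ge0 (N k s : nat) : 0 <= partial_moment N k s.
Proof.
elim: N k s => [//|N IH] k s /=; apply: sumr_ge0 => i _.
by rewrite mulr_ge0// mulr_ge0 ?coef_ge0 ?IH.
Qed.

(** The recurrence has nonnegative coefficients, so only its first step matters, and there the term
    [i = 0] alone is already 1. *)
Lemma nondecreasing_partial_moment (k s : nat) :
  nondecreasing_seq (fun N => partial_moment N k s).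
Proof.
apply/nondecreasing_seqP => N; elim: N k s => [|N IH] k s.
  rewrite [leRHS]/= big_ord_recl/= bin0 mul0r addr0 divff ?pnatr_eq0//.
  rewrite !mul1r lerDl sumr_ge0// => i _; rewrite mulr_ge0//.
  by rewrite mulr1 coef_ge0.
apply: ler_sum => i _; rewrite ler_wpM2l// ler_wpM2l//; exact: IH.
Qed.

Lemma partial_moment_le (N k s : nat) : partial_moment N k s <= moment k s.
Proof.
elim: N k s => [|N IH] k s; first exact: moment_ge1.
rewrite moment_rec; apply: ler_sum => i _.
by rewrite ler_wpM2l// ler_wpM2l//; exact: IH.
Qed.

Lemma harmonic_unbounded (A : R) (a : nat) :
  exists n, A < \sum_(i < n) (a + i).+1%:R^-1.
Proof.
apply: contrapT => /forallNP H; apply: (@dvg_harmonic R).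
apply: nondecreasing_is_cvgn.
  by apply/nondecreasing_seqP => n; rewrite seriesSr/= lerDl harmonic_ge0.
(* The first [a] terms plus the supposed bound on all the shifted sums. *)
exists (series harmonic a + A) => _ [n _ <-].
have [na|/ltnW an] := leqP n a.
  apply: (@le_trans _ _ (series harmonic a)).
    by apply: (nondecreasing_series (P := xpredT)) => // i _ _; exact: harmonic_ge0.
  rewrite lerDl leNgt; apply/negP => A0; apply: (H 0%N); rewrite big_ord0.
  exact: A0.
rewrite -(subnKC an) /series/= (big_cat_nat (n := a))//= ?leq_addr// lerD2l.
rewrite leNgt; apply/negP => AS; apply: (H (n - a)%N).
by rewrite (lt_le_trans AS)// -{1}[a]add0n big_addn addKn big_mkord; under eq_bigr do rewrite addnC.
Qed.

(* Multiplying by s!/(s + k)! turns the bound into a constant and the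
   recurrence into growth by the divergent product of the
   1 + k (gamma - 1) / (s + 1 + k). *)
Lemma recurrence_bounded_eq0 (k : nat) (D : nat -> R) (B : R) : (0 < k)%N ->
  (forall s, 0 <= D s) -> (forall s, D s <= B * ((s + k)%N`!%:R / s`!%:R)) ->
  (forall s, D s = s.+1%:R / (s.+1%:R + k%:R * gamma) * D s.+1) ->
  forall s, D s = 0.
Proof.
move=> k0 D0 DB Drec s.
pose d t := D t * (t`!%:R / (t + k)%N`!%:R).
have d0 t : 0 <= d t by rewrite mulr_ge0// divr_ge0.
have dB t : d t <= B.
  rewrite -ler_pdivlMr ?divr_gt0 ?ltr0n ?fact_gt0// invf_div; exact: DB.
(* Chosen so that [(t + 1 + k gamma) / (t + 1 + k)], the quotient of consecutive values of [d], is
   [1 + eps / (t + k + 1)]. *)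
pose eps := k%:R * (gamma - 1).
have eps0 : 0 < eps by rewrite mulr_gt0 ?ltr0n// subr_gt0.
have dS t : d t.+1 = d t * (1 + eps / (t + k).+1%:R).
  rewrite /d (Drec t) addSn !factS !natrM /eps.
  have ? := factr_neq0 t; have ? := factr_neq0 (t + k).
  have f1 : t.+1%:R != 0 :> R by rewrite pnatr_eq0.
  have f2 : (t + k).+1%:R != 0 :> R by rewrite pnatr_eq0.
  have f3 : t.+1%:R + k%:R * gamma != 0.
    by rewrite lt0r_neq0// ltr_pwDl// mulr_ge0// ltW// (lt_trans ltr01).
  rewrite -addSn natrD in f2 *.
  by field; rewrite !nat1r f2 f3 andbT.
have dmon : nondecreasing_seq d.
  by apply/nondecreasing_seqP => t; rewrite dS ler_peMr// lerDl divr_ge0// ltW.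
(* Since [d] is nondecreasing, each increment [d t * eps / (t + k + 1)] is at least the same with
   [d s], so a sum replaces the product. *)
have growth n : d s * (1 + eps * \sum_(i < n) (s + k + i).+1%:R^-1) <= d (s + n)%N.
  elim: n => [|n IH]; first by rewrite big_ord0 mulr0 addr0 mulr1 addn0.
  rewrite big_ord_recr/= addnS dS [eps * _]mulrDr addrA mulrDr [leRHS]mulrDr mulr1.
  by rewrite lerD// addnAC ler_wpM2r ?dmon ?leq_addr// divr_ge0// ltW.
apply: contrapT => /eqP Ds0.
have ds0 : 0 < d s.
  by rewrite mulr_gt0 ?lt_neqAle ?D0 1?eq_sym ?Ds0// divr_ge0 ?andbT// mulf_neq0// invr_neq0.
have [n] := harmonic_unbounded (B / d s / eps) (s + k).
rewrite ltr_pdivrMr// ltr_pdivrMr// => Bn.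
suff : B < B by rewrite ltxx.
apply: (lt_le_trans Bn); apply: le_trans (dB (s + n)%N); apply: le_trans (growth n).
by rewrite mulrC [_ * eps]mulrC ler_wpM2l// lerDr.
Qed.

(** Strong induction on [k]: once the limits of lower order are known, only the term [i = k]
    survives in the recurrence for [moment k s - L k s], which [recurrence_bounded_eq0] then
    annihilates. *)
Lemma partial_moment_cvg (k s : nat) :
  partial_moment N k s @[N --> \oo] --> moment k s.
Proof.
pose L k s := limn (fun N => partial_moment N k s).
have Lcvg i t : partial_moment N i t @[N --> \oo] --> L i t.
  apply: nondecreasing_is_cvgn; first exact: nondecreasing_partial_moment.
  by exists (moment i t) => _ [N _ <-]; exact: partial_moment_le.
have Lle i t : L i t <= moment i t.
  by apply: limr_le; [exact: Lcvg|apply: nearW => N; exact: partial_moment_le].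
have Lge0 i t : 0 <= L i t.
  by apply: limr_ge; [exact: Lcvg|apply: nearW => N; exact: partial_moment_ge0].
have Lrec i t : L i t = \sum_(l < i.+1) 'C(i, l)%:R *
    (t.+1%:R / (t.+1%:R + l%:R * gamma) * L l t.+1).
  apply: (@cvg_unique _ _ ((fun N => partial_moment N.+1 i t) @ \oo)) => //.
    by move: (Lcvg i t); rewrite -cvg_shiftS; exact.
  apply: cvg_big => [|l _]; first exact: add_continuous.
  by do 2 apply: cvgMr; exact: Lcvg.
suff -> : moment k s = L k s by exact: Lcvg.
elim/ltn_ind: k s => k IH s; apply/eqP; rewrite -subr_eq0; apply/eqP; move: s.
(* For [k = 0] the homogeneous recurrence has constant solutions, so this case is direct: the moment
   equals the starting value 1. *)
have [k0|k0] := posnP k.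
  have m0 s : moment 0 s = 1.
    rewrite /moment big_ord1 mul1r /central_moment big_ord1 addn0.
    by rewrite divff ?factr_neq0// bellc0 mulr1.
  move=> s; rewrite k0; apply/eqP; rewrite subr_eq0 eq_le Lle andbT m0.
  apply: limr_ge; first exact: Lcvg.
  apply: nearW => N; exact: (nondecreasing_partial_moment 0 s 0 N).
have [B mB] := moment_bound k.
apply: (recurrence_bounded_eq0 k _ B) => //.
- by move=> s; rewrite subr_ge0.
- by move=> s; rewrite (le_trans _ (mB s))// gerBl.
- move=> s; rewrite moment_rec Lrec -sumrB big_ord_recr/= big1 ?add0r.
    by rewrite binn !mul1r -mulrBr.
  by move=> i _; rewrite IH ?subrr.
Qed.

End bell.

(** * Integration against the exponential law *)

Section density.
Local Open Scope ereal_scope.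
Context {R : realType} (nu : {finite_measure set (measurableTypeR R) -> \bar R}) (f : R -> R).
Local Notation mu := (@lebesgue_measure R).
Context (f0 : forall x, (0 <= f x)%R) (mf : measurable_fun setT f)
  (nuE : forall A, measurable A -> nu A = \int[mu]_(x in A) (f x)%:E).

Let nu_mu : nu `<< mu.
Proof.
apply/null_content_dominatesP => A mA A0; rewrite nuE//.
apply: null_set_integral => //.
by apply/measurable_EFinP/measurable_funTS.
Qed.

(** The Radon-Nikodym derivative of [nu] and [f] have the same integral over every measurable set,
    hence agree almost everywhere. *)
Lemma ge0_integral_density (g : R -> \bar R) :
  measurable_fun setT g -> (forall x, 0 <= g x) ->
  \int[nu]_x g x = \int[mu]_x (g x * (f x)%:E).
Proof.
move=> mg g0.
rewrite -(Radon_Nikodym_SigmaFinite.change_of_variables nu_mu)//.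
have fi := Radon_Nikodym_SigmaFinite.f_integrable nu_mu.
apply: ae_eq_integral => //.
- by apply: emeasurable_funM => //; exact: measurable_int fi.
- by apply: emeasurable_funM => //; exact/measurable_EFinP.
apply: ae_eqe_mul2l; apply: integral_ae_eq => //.
- exact/measurable_EFinP.
- move=> A AT mA.
  by rewrite -nuE// -Radon_Nikodym_SigmaFinite.f_integral.
Qed.

End density.

(** Agreement on half-open intervals determines the measure; this is translation invariance. *)
Lemma lebesgue_measureD {R : realType} (a : R) (A : set R) : measurable A ->
  pushforward lebesgue_measure ((fun x => a + x) : _ -> measurableTypeR R) A =
  lebesgue_measure A.
Proof.
move=> mA; apply/esym/lebesgue_measure_unique => //=.
  exact: measurable_funD.
move=> ma _ [[b c]] _ <-.
rewrite /pushforward.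
rewrite (_ : _ @^-1` _ = `](b - a), (c - a)]%classic).
  by rewrite !lebesgue_measure_itv/= !lte_fin ltrD2r -!EFinB; case: ifP => // _; congr EFin; ring.
by apply/seteqP; split => x /=; rewrite !in_itv/= ltrBlDl lerBrDl.
Qed.

Lemma ge0_integral_shift {R : realType} (a : R) (g : R -> \bar R) :
  measurable_fun setT g -> (forall x, (0 <= g x)%E) ->
  (\int[lebesgue_measure]_x g (a + x)%R = \int[lebesgue_measure]_x g x)%E.
Proof.
move=> mg g0.
have ma : measurable_fun setT ((fun x => a + x) : R -> measurableTypeR R).
  by apply: measurable_funD.
transitivity (\int[pushforward lebesgue_measure
    ((fun x => a + x)%R : _ -> measurableTypeR R)]_x g x)%E.
  by rewrite ge0_integral_pushforward.
by apply: eq_measure_integral => //= A mA _; exact: lebesgue_measureD.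
Qed.

Lemma derivable_oo_LRcontinuous_powR {R : realType} (a v : R) : 0 < a -> 0 < v ->
  derivable_oo_LRcontinuous (fun x : R => x `^ a) 0 v.
Proof.
move=> a0 v0; split.
- by move=> x; rewrite in_itv/= => /andP[x0 _]; apply: derivable_powR; rewrite in_itv/= x0.
- by rewrite powR0 ?gt_eqF//; exact: powR_cvg0.
- apply: cvg_at_left_filter.
  have /derivable1_diffP/differentiable_continuous : derivable (fun x : R => x `^ a) v 1.
    by apply: derivable_powR; rewrite in_itv/= v0.
  exact.
Qed.

Lemma integral_powR {R : realType} (a v : R) : 0 <= a -> 0 <= v ->
  (\int[lebesgue_measure]_(x in `[0%R, v]) (x `^ a)%:E = (v `^ (a + 1) / (a + 1))%:E)%E.
Proof.
move=> a0; have a1 : 0 < a + 1 by rewrite ltr_pwDr.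
rewrite le_eqVlt => /predU1P[<-|v0].
  by rewrite set_itv1 integral_set1 powR0 ?mul0r// gt_eqF.
have LR := derivable_oo_LRcontinuous_powR (a + 1) v a1 v0.
rewrite (continuous_FTC2 (F := fun x => (a + 1)^-1 * x `^ (a + 1)) v0).
- by rewrite powR0 ?gt_eqF// mulr0 sube0 mulrC.
(* For [a = 0] the integrand is the constant 1, also at the origin; the general continuity lemma
   asks for a positive exponent. *)
- move: a0; rewrite le_eqVlt => /predU1P[<-|a0].
    rewrite (_ : (fun x : R => x `^ 0) = cst 1); last by apply/funext => x; rewrite powRr0.
    by apply: continuous_subspaceT => x; exact: cvg_cst.
  exact/derivable_oo_LRcontinuous_within/derivable_oo_LRcontinuous_powR.
- case: LR => dF F0 Fv; split.
  + by move=> x xv; apply: derivableM => //; exact: dF.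
  + exact: cvgMr.
  + exact: cvgMr.
- move=> x; rewrite in_itv/= => /andP[x0 xv].
  rewrite derive1E deriveM//; last by apply: derivable_powR; rewrite in_itv/= x0.
  have dx : is_derive x 1 (fun x => x `^ (a + 1)) ((a + 1) * x `^ (a + 1 - 1)).
    exact: is_derive1_powR.
  rewrite derive_cst scaler0 addr0 derive_val addrK.
  by rewrite /GRing.scale/= mulrA mulVf ?mul1r// gt_eqF.
Qed.

Section exponential_convolution.
Context {R : realType}.
Local Notation e1 := (exponential_pdf (1 : R)).
Local Notation mu := (@lebesgue_measure R).

Lemma exponential_pdf_mul (x v : R) : e1 x * e1 (v - x) = e1 v * \1_`[0%R, v]%classic x.
Proof.
rewrite indicE mem_setE in_itv/=.
have [x0|x0] := ltP x 0; first by rewrite lt0_exponential_pdf// mul0r mulr0.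
have [vx|vx] := ltP v x.
  by rewrite (lt0_exponential_pdf _ (x := v - x)) ?subr_lt0// mulr0 mulr0.
rewrite !exponential_pdfE ?subr_ge0// ?(le_trans x0)// !mul1r mulr1 -expRD.
by congr expR; ring.
Qed.

Lemma integral_exponential_pdf_mul (a v : R) : 0 <= a ->
  (\int[mu]_x (x `^ a * (e1 x * e1 (v - x)))%:E =
   (e1 v * (v `^ (a + 1) / (a + 1)))%:E)%E.
Proof.
move=> a0.
transitivity (\int[mu]_x ((e1 v)%:E * (x `^ a * \1_`[0%R, v]%classic x)%:E))%E.
  by apply: eq_integral => x _; rewrite exponential_pdf_mul -EFinM; congr EFin; ring.
rewrite ge0_integralZl_EFin//; last 3 first.
- by move=> x _; rewrite lee_fin mulr_ge0 ?powR_ge0.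
- by apply/measurable_EFinP/measurable_funM => //; exact: measurable_powR.
- exact: exponential_pdf_ge0.
have [v0|v0] := ltP v 0; first by rewrite lt0_exponential_pdf// !mul0r mul0e.
rewrite EFinM -integral_powR//; congr (_ * _)%E.
rewrite [RHS]integral_mkcond; apply: eq_integral => x _.
by rewrite epatch_indic EFinM.
Qed.

(** Substitute [y = v - x], exchange the integrals, and note that [e1 x * e1 (v - x)] depends on [x]
    only through [0 <= x <= v], which leaves the integral of a power. *)
Lemma ge0_integral_exponential_convolution (a : R) (g : R -> \bar R) : 0 <= a ->
  measurable_fun setT g -> (forall x, (0 <= g x)%E) ->
  (\int[mu]_x \int[mu]_y (g (x + y)%R * (x `^ a * (e1 x * e1 y))%:E) =
   \int[mu]_v (g v * (e1 v * (v `^ (a + 1) / (a + 1)))%:E))%E.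
Proof.
move=> a0 mg g0.
have e0 x : 0 <= e1 x by exact: exponential_pdf_ge0.
have me := @measurable_exponential_pdf R 1.
have c0 x v : 0 <= x `^ a * (e1 x * e1 v) by rewrite mulr_ge0 ?powR_ge0// mulr_ge0.
pose h (z : R * R) := (g z.2 * (z.1 `^ a * (e1 z.1 * e1 (z.2 - z.1)))%:E)%E.
have mh : measurable_fun setT h.
  apply: emeasurable_funM; first exact: (measurableT_comp mg measurable_snd).
  apply/measurable_EFinP/measurable_funM.
    exact: (measurableT_comp (measurable_powR _) measurable_fst).
  apply: measurable_funM; apply: (measurableT_comp me) => //.
  exact: measurable_funB.
have h0 z : (0 <= h z)%E by rewrite mule_ge0// lee_fin c0.
transitivity (\int[mu]_x \int[mu]_v h (x, v))%E.
  apply: eq_integral => x _; rewrite -[RHS](ge0_integral_shift x)//=.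
    by apply: eq_integral => y _; rewrite /h/= addrAC subrr add0r.
  exact: measurableT_comp.
rewrite fubini_tonelli//; apply: eq_integral => v _; rewrite /h/=.
rewrite -integral_exponential_pdf_mul//.
have mx : measurable_fun setT (fun x => (x `^ a * (e1 x * e1 (v - x)))%:E).
  apply/measurable_EFinP/measurable_funM; first exact: measurable_powR.
  apply: measurable_funM => //; apply: measurableT_comp => //.
  exact: measurable_funB.
by rewrite ge0_integralZl// => x _; rewrite lee_fin c0.
Qed.

End exponential_convolution.

(** * Independence of the ratio of consecutive Gamma variables *)

Section past.
Context {d : measure_display} {T : measurableType d} {R : realType}
  {P : probability T R} (E : nat -> {RV P >-> R}).
Context (hE : iid_exponential1 E).
Local Notation e1 := (exponential_pdf (1 : R)).
Local Notation mu := (@lebesgue_measure R).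

Lemma ge0_integral_exponential (m : nat) (g : R -> \bar R) :
  measurable_fun setT g -> (forall x, (0 <= g x)%E) ->
  (\int[P]_w g (E m w) = \int[mu]_y (g y * (e1 y)%:E))%E.
Proof.
move=> mg g0.
have mE : @measurable_fun _ _ T (measurableTypeR R) setT (E m).
  exact: (measurable_funP (E m)).
(* The Lebesgue measure lives on measurableTypeR R, whose display differs from
   that of R. *)
pose X : {RV P >-> measurableTypeR R} :=
  HB.pack (E m : T -> measurableTypeR R) (isMeasurableFun.Build _ _ _ _ _ mE).
transitivity (\int[distribution P X]_y g y)%E.
  by rewrite ge0_integral_distribution.
apply: ge0_integral_density => //.
- exact: measurable_exponential_pdf.
- by move=> A mA; have [_ hA] := hE; exact: (hA m A mA).
Qed.

(** A family closed under intersection that generates the sigma-algebra of the first [m]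
    variables. *)
Definition past_cylinders (m : nat) : set (set T) :=
  [set B | exists2 A : nat -> set R, (forall i, measurable (A i)) &
     B = \bigcap_(i in [set` iota 0 m]) (E i @^-1` A i)].

(** The sample space with this smaller sigma-algebra, so that dependence on the past alone becomes a
    measurability statement. *)
Definition pastType (m : nat) := g_sigma_algebraType (past_cylinders m).

Lemma measurable_past (m : nat) : past_cylinders m `<=` measurable.
Proof.
move=> _ [A mA ->]; apply: fin_bigcap_measurable; first exact: finite_seq.
by move=> i _; exact: measurable_funPTI.
Qed.

(** For fixed [A] both sides are finite measures in [B], and they agree on the cylinders by mutual
    independence. *)
Lemma past_indep (m : nat) (B : set T) (A : set R) :
  <<s past_cylinders m >> B -> measurable A ->
  (P (B `&` E m @^-1` A) = P B * P (E m @^-1` A))%E.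
Proof.
move=> mB mA.
have mEA : measurable (E m @^-1` A) by exact: measurable_funPTI.
pose r := fine (P (E m @^-1` A)).
have r0 : 0 <= r by rewrite fine_ge0.
have rE : (r%:E = P (E m @^-1` A))%E by rewrite fineK// fin_num_measure.
pose m1 : {measure set T -> \bar R} := mrestr P mEA.
pose m2 : {measure set T -> \bar R} := mscale (NngNum r0) P.
rewrite -[LHS]/(m1 B) -rE muleC -[RHS]/(m2 B).
apply: (g_sigma_algebra_measure_unique (past_cylinders m) _ (fun=> setT)) => //.
- exact: measurable_past.
- move=> _; exists (fun=> setT) => //; apply/seteqP; split => //.
- by rewrite bigcup_const//; exists 0%N.
- move=> _ _ [A1 mA1 ->] [A2 mA2 ->]; exists (fun i => A1 i `&` A2 i).
    by move=> i; exact: measurableI.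
  by rewrite -bigcapI; apply: eq_bigcapr => i _; rewrite preimage_setI.
- move=> _ [A' mA' ->].
  (* Puts [A] in position [m] of the cylinder, so that independence applies to the list
     [m :: iota 0 m]. *)
  pose A'' i := if i == m then A else A' i.
  have mA'' i : measurable (A'' i) by rewrite /A''; case: eqP.
  have mm : m \notin iota 0 m by rewrite mem_iota add0n ltnn andbF.
  have A'E : \bigcap_(i in [set` iota 0 m]) E i @^-1` A' i =
      \bigcap_(i in [set` iota 0 m]) E i @^-1` A'' i.
    apply: eq_bigcapr => i /= im; rewrite /A'' ifF//.
    by apply/negbTE; apply: contraTneq im => ->.
  rewrite /m1 /m2 /= /mrestr /mscale/= -[X in (X * _)%E]/(r%:E) rE A'E.
  have [indep _] := hE.
  have A''m : E m @^-1` A = E m @^-1` A'' m by rewrite /A'' eqxx.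
  have consE : [set` m :: iota 0 m] = m |` [set` iota 0 m].
    by apply/seteqP; split => i /=; rewrite inE => /predU1P.
  rewrite A''m setIC -(bigcap_setU1 (fun i => E i @^-1` A'' i)) -consE.
  rewrite [in RHS]indep ?iota_uniq//.
  by rewrite indep ?big_cons//= mm iota_uniq.
- by move=> _; rewrite /m1/= /mrestr setTI (le_lt_trans (probability_le1 _ _))// ltry.
Qed.

Section joint_law.
Context {d'} {T' : measurableType d'} (m : nat) (f : T -> T').
Context (mf : measurable_fun [set: pastType m] (f : pastType m -> T')).

Lemma measurable_past_fun : measurable_fun setT f.
Proof.
move=> _ B mB; rewrite setTI.
apply: (smallest_sub (@sigma_algebra_measurable _ T) (@measurable_past m)).
by have := mf measurableT _ mB; rewrite setTI.
Qed.

(** By [past_indep] the joint law of [f] and [E m] is the product of the marginals, so Tonelli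
    integrates the newest exponential out first. *)
Lemma ge0_integral_past (F : T' * R -> \bar R) :
  measurable_fun setT F -> (forall z, (0 <= F z)%E) ->
  (\int[P]_w F (f w, E m w) = \int[P]_w \int[mu]_y (F (f w, y) * (e1 y)%:E))%E.
Proof.
move=> mF F0.
have mfT := measurable_past_fun.
have mfE : measurable_fun setT (fun w => (f w, E m w)).
  by apply/measurable_fun_pairP; split.
pose X : {RV P >-> T'} := HB.pack f (isMeasurableFun.Build _ _ _ _ _ mfT).
pose Y : {RV P >-> (T' * R)%type} :=
  HB.pack (fun w => (f w, E m w)) (isMeasurableFun.Build _ _ _ _ _ mfE).
pose nu : probability R R := distribution P (E m).
have XE : forall Z, measurable Z -> (distribution P X \x nu)%E Z = distribution P Y Z.
  apply: product_measure_unique => A B mA mB.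
  rewrite /nu /distribution /pushforward -past_indep//.
  by have := mf measurableT _ mA; rewrite setTI.
transitivity (\int[distribution P Y]_z F z)%E.
  by rewrite ge0_integral_distribution.
transitivity (\int[distribution P X \x nu]_z F z)%E.
  by apply: eq_measure_integral => A mA _; exact: (esym (XE _ mA)).
rewrite fubini_tonelli1// ge0_integral_distribution//; last 2 first.
- exact: measurable_fun_fubini_tonelli_F.
- by move=> x; apply: integral_ge0 => y _.
apply: eq_integral => w _; rewrite /fubini_F/= ge0_integral_distribution//.
  by apply: ge0_integral_exponential => //; exact: measurableT_comp.
exact: measurableT_comp.
Qed.

End joint_law.
End past.

Lemma powRD_ge0 {R : realType} (x a b : R) : 0 <= a -> 0 <= b ->
  x `^ (a + b) = x `^ a * x `^ b.
Proof.
move=> a0 b0; have [ab|ab] := eqVneq (a + b) 0; last by rewrite powRD// (negPf ab).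
move/eqP: ab; rewrite paddr_eq0// => /andP[/eqP-> /eqP->].
by rewrite addr0 !powRr0 mulr1.
Qed.

(** * The Gamma law and the chain of partial sums *)

Section gamma_law.
Context {d : measure_display} {T : measurableType d} {R : realType}
  {P : probability T R} (E : nat -> {RV P >-> R}).
Context (hE : iid_exponential1 E).
Local Notation e1 := (exponential_pdf (1 : R)).
Local Notation mu := (@lebesgue_measure R).
Local Notation G := (Gamma (fun i => E i : T -> R)).

Lemma measurable_past_RV (m i : nat) : (i < m)%N ->
  measurable_fun [set: pastType E m] (E i : pastType E m -> R).
Proof.
move=> im _ B mB; rewrite setTI; apply: sub_sigma_algebra.
exists (fun j => if j == i then B else setT) => [j|]; first by case: ifP.
apply/seteqP; split => [w Bw j _ /=|w /(_ i)/=]; first by case: eqP => // ->.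
by rewrite mem_iota leq0n add0n im eqxx; exact.
Qed.

Lemma measurable_past_Gamma (m k : nat) : (k <= m)%N ->
  measurable_fun [set: pastType E m] (G k : pastType E m -> R).
Proof.
move=> km; apply: measurable_sum => i; apply: measurable_past_RV.
exact: leq_trans (ltn_ord i) km.
Qed.

Lemma measurable_Gamma (k : nat) : measurable_fun setT (G k).
Proof. by apply: measurable_sum => i. Qed.

Lemma GammaS (k : nat) (w : T) : G k.+1 w = G k w + E k w.
Proof. by rewrite /Gamma big_ord_recr. Qed.

Let e1_ge0 x : 0 <= e1 x. Proof. exact: exponential_pdf_ge0. Qed.
Let me1 := @measurable_exponential_pdf R 1.

(** The law of [Gamma_(s+1)] is a hypothesis because the lemma serves twice: with [p = 0] inside the
    induction proving that law, then with general [p] for the ratio. *)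
Lemma ge0_integral_Gamma_pow_step (s : nat) (p : R) (g : R -> \bar R) : 0 <= p ->
  measurable_fun setT g -> (forall x, (0 <= g x)%E) ->
  (forall h : R -> \bar R, measurable_fun setT h -> (forall x, (0 <= h x)%E) ->
    \int[P]_w h (G s.+1 w) = \int[mu]_x (h x * (e1 x * (x `^ s%:R / s`!%:R))%:E))%E ->
  (\int[P]_w ((G s.+1 w `^ p)%:E * g (G s.+2 w)) =
   \int[mu]_v (g v * (e1 v * (v `^ (s%:R + p + 1) / (s%:R + p + 1) / s`!%:R))%:E))%E.
Proof.
move=> p0 mg g0 law.
pose F (z : R * R) := ((z.1 `^ p)%:E * g (z.1 + z.2)%R)%E.
have F0 z : (0 <= F z)%E by rewrite mule_ge0// lee_fin powR_ge0.
have mF : measurable_fun setT F.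
  apply: emeasurable_funM.
    by apply/measurable_EFinP; exact: (measurableT_comp (measurable_powR _) measurable_fst).
  by apply: (measurableT_comp mg); exact: measurable_funD.
have mFe : measurable_fun setT (fun z : R * R => F z * (e1 z.2)%:E)%E.
  apply: emeasurable_funM => //.
  by apply/measurable_EFinP; exact: (measurableT_comp me1 measurable_snd).
have Fe0 z : (0 <= F z * (e1 z.2)%:E)%E by rewrite mule_ge0// lee_fin.
transitivity (\int[P]_w F (G s.+1 w, E s.+1 w))%E.
  by apply: eq_integral => w _; rewrite (GammaS s.+1).
rewrite (ge0_integral_past _ hE s.+1 (G s.+1) _ F)//; last exact: measurable_past_Gamma.
rewrite (law (fun x => \int[mu]_y (F (x, y) * (e1 y)%:E))%E); last 2 first.
- exact: (@measurable_fun_fubini_tonelli_F _ _ R (measurableTypeR R) R mu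
    (fun z => F z * (e1 z.2)%:E)%E mFe Fe0).
- by move=> x; apply: integral_ge0 => y _; exact: (Fe0 (x, y)).
transitivity (\int[mu]_x \int[mu]_y ((s`!%:R^-1)%:E * g (x + y)%R *
    (x `^ (s%:R + p) * (e1 x * e1 y))%:E))%E.
  apply: eq_integral => x _; rewrite -ge0_integralZr//; last 2 first.
  - exact: (measurableT_comp mFe (@pair1_measurable _ _ R R x)).
  - by rewrite lee_fin mulr_ge0// divr_ge0// powR_ge0.
  apply: eq_integral => y _; rewrite /F/= powRD_ge0//.
  move: (g _) => gxy; rewrite (muleC _ gxy) (muleC _ gxy) -!muleA -!EFinM.
  by congr (_ * _%:E)%E; ring.
rewrite (ge0_integral_exponential_convolution _ (fun v => (s`!%:R^-1)%:E * g v)%E)//.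
- apply: eq_integral => v _; rewrite -muleA muleCA -EFinM; congr (_ * _%:E)%E.
  by ring.
- by rewrite addr_ge0.
- exact: emeasurable_funM.
- by move=> x; rewrite mule_ge0// lee_fin.
Qed.

Lemma ge0_integral_Gamma (s : nat) (g : R -> \bar R) :
  measurable_fun setT g -> (forall x, (0 <= g x)%E) ->
  (\int[P]_w g (G s.+1 w) =
   \int[mu]_x (g x * (e1 x * (x `^ s%:R / s`!%:R))%:E))%E.
Proof.
elim: s g => [|s IH] g mg g0.
  transitivity (\int[P]_w g (E 0%N w))%E.
    by apply: eq_integral => w _; rewrite /Gamma big_ord1.
  rewrite (ge0_integral_exponential _ hE)//; apply: eq_integral => x _.
  by rewrite powRr0 fact0 divr1 mulr1.
transitivity (\int[P]_w ((G s.+1 w `^ 0)%:E * g (G s.+2 w)))%E.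
  by apply: eq_integral => w _; rewrite powRr0 mul1e.
rewrite (ge0_integral_Gamma_pow_step s)//; apply: eq_integral => x _.
rewrite addr0 natr1 factS natrM; congr (_ * (_ * _)%:E)%E.
by rewrite -mulrA -invfM.
Qed.

(** Once [v^(-p)] is absorbed in the test function, the density left is that of [Gamma_(s+2)] up to
    the constant [(s + 1) / (s + 1 + p)]. *)
Lemma Gamma_ratio_indep (s : nat) (p : R) (g : R -> \bar R) : 0 <= p ->
  measurable_fun setT g -> (forall x, (0 <= g x)%E) ->
  (\int[P]_w ((G s.+1 w `^ p * G s.+2 w `^ (- p))%:E * g (G s.+2 w)) =
   (s.+1%:R / (s.+1%:R + p))%:E * \int[P]_w g (G s.+2 w))%E.
Proof.
move=> p0 mg g0.
pose h v := ((v `^ (- p))%:E * g v)%E.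
have mh : measurable_fun setT h.
  by apply: emeasurable_funM => //; apply/measurable_EFinP; exact: measurable_powR.
have h0 v : (0 <= h v)%E by rewrite mule_ge0// lee_fin powR_ge0.
transitivity (\int[P]_w ((G s.+1 w `^ p)%:E * h (G s.+2 w)))%E.
  by apply: eq_integral => w _; rewrite /h muleA -EFinM.
have s1p : s.+1%:R + p != 0 :> R by rewrite lt0r_neq0// ltr_pwDl.
rewrite (ge0_integral_Gamma_pow_step s)//; last exact: ge0_integral_Gamma.
rewrite ge0_integral_Gamma// -ge0_integralZl//; last 3 first.
- apply: emeasurable_funM => //; apply/measurable_EFinP; apply: measurable_funM => //.
  by apply: measurable_funM => //; exact: measurable_powR.
- by move=> v _; rewrite mule_ge0// lee_fin mulr_ge0// divr_ge0// powR_ge0.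
- by rewrite lee_fin divr_ge0// addr_ge0.
apply: eq_integral => v _; rewrite /h (muleC _ (g v)) muleCA -!muleA -!EFinM.
congr (_ * _%:E)%E.
have -> : v `^ s.+1%:R = v `^ (- p) * v `^ (s%:R + p + 1).
  rewrite -powRD; last by rewrite (_ : - p + _ = s.+1%:R) ?pnatr_eq0// -natr1; ring.
  by congr powR; rewrite -natr1; ring.
rewrite factS natrM.
have ? := factr_neq0 (R := R) s; have ? : s.+1%:R != 0 :> R by rewrite pnatr_eq0.
have -> : s%:R + p + 1 = s.+1%:R + p :> R by rewrite -natr1; ring.
move: s1p; move: (s.+1%:R + p) => q q0.
by field; rewrite nat1r; apply/and3P.
Qed.

(* The state (Gamma_(s+2), current partial sum, last Gamma) is a Markov chain
   driven by E. *)
Definition state_step (gamma : R) (z : (R * R * R) * R) : R * R * R :=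
  (z.1.1.1, z.1.1.2 + (z.1.2 + z.2) `^ (- gamma), z.1.2 + z.2).

Definition state (gamma : R) (s N : nat) (w : T) : R * R * R :=
  (G s.+2 w, \sum_(s.+2 <= k < s.+3 + N) G k w `^ (- gamma), G (s.+2 + N) w).

Lemma stateS (gamma : R) (s N : nat) (w : T) :
  state gamma s N.+1 w = state_step gamma (state gamma s N w, E (s.+2 + N)%N w).
Proof.
rewrite /state /state_step/= addnS big_nat_recr/=; last by rewrite addSnnS leq_addr.
by rewrite addnS -GammaS (GammaS (s.+2 + N)).
Qed.

Lemma measurable_state_step (gamma : R) : measurable_fun setT (state_step gamma).
Proof.
have m1 : measurable_fun setT (fun z : (R * R * R) * R => z.1.2 + z.2).
  by apply: measurable_funD => //; exact: measurableT_comp.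
apply/measurable_fun_pairP; split => //=; apply/measurable_fun_pairP; split => /=.
  exact: (measurableT_comp measurable_fst (measurableT_comp measurable_fst measurable_fst)).
apply: measurable_funD.
  exact: (measurableT_comp measurable_snd (measurableT_comp measurable_fst measurable_fst)).
exact: (measurableT_comp (measurable_powR _) m1).
Qed.

Lemma measurable_past_state (gamma : R) (s N : nat) :
  measurable_fun [set: pastType E (s.+2 + N)]
    (state gamma s N : pastType E (s.+2 + N) -> R * R * R).
Proof.
have mG := measurable_past_Gamma (s.+2 + N).
apply/measurable_fun_pairP; split => /=; last exact: mG.
apply/measurable_fun_pairP; split => /=; first by apply: mG; rewrite leq_addr.
rewrite (_ : _ \o _ = fun w => \sum_(k < N.+1) G (k + s.+2)%N w `^ (- gamma)).
  apply: measurable_sum => k; apply: (measurableT_comp (measurable_powR _)).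
  by apply: mG; rewrite addnC leq_add2l -ltnS.
apply/funext => w /=.
by rewrite -{1}[s.+2]add0n big_addn addSn -addnS addKn big_mkord.
Qed.

(** Induction on [N]: integrating out the newest exponential turns a function of the state at
    [N + 1] into one of the state at [N]. The initial state is a function of [Gamma_(s+2)] alone. *)
Lemma state_ratio_indep (gamma p : R) (s N : nat) (g : R * R * R -> \bar R) : 0 <= p ->
  measurable_fun setT g -> (forall z, (0 <= g z)%E) ->
  (\int[P]_w ((G s.+1 w `^ p * G s.+2 w `^ (- p))%:E * g (state gamma s N w)) =
   (s.+1%:R / (s.+1%:R + p))%:E * \int[P]_w g (state gamma s N w))%E.
Proof.
move=> p0; elim: N g => [|N IH] g mg g0.
  pose k v := g (v, v `^ (- gamma), v).
  have stateE w : g (state gamma s 0 w) = k (G s.+2 w).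
    by rewrite /state /k addn0 big_nat1 addn0.
  under eq_integral do rewrite stateE.
  under [in RHS]eq_integral do rewrite stateE.
  apply: Gamma_ratio_indep => [//||x]; last exact: g0.
  apply: (measurableT_comp mg); apply/measurable_fun_pairP; split => //=.
    by apply/measurable_fun_pairP; split; [exact: measurable_id|exact: (measurable_powR (- gamma))].
  exact: measurable_id.
pose m := (s.+2 + N)%N.
pose h (z : (R * R * R) * R) := g (state_step gamma z).
have mh : measurable_fun setT h by exact: (measurableT_comp mg (measurable_state_step _)).
pose he (z : (R * R * R) * R) := (h z * (e1 z.2)%:E)%E.
have h0 z : (0 <= h z)%E by exact: g0.
have he0 z : (0 <= he z)%E by rewrite mule_ge0 ?lee_fin.
have mhe : measurable_fun setT he.
  apply: emeasurable_funM => //.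
  by apply/measurable_EFinP; exact: (measurableT_comp me1 measurable_snd).
(* The transition operator of the chain applied to [g]. *)
pose k z := (\int[mu]_y he (z, y))%E.
have mk : measurable_fun setT k.
  exact: (@measurable_fun_fubini_tonelli_F _ _ _ (measurableTypeR R) R mu he mhe he0).
have k0 z : (0 <= k z)%E by apply: integral_ge0 => y _.
have mstate : measurable_fun [set: pastType E m] (state gamma s N : pastType E m -> _).
  exact: measurable_past_state.
have rhsE : (\int[P]_w g (state gamma s N.+1 w) = \int[P]_w k (state gamma s N w))%E.
  under eq_integral do rewrite stateS.
  by rewrite (ge0_integral_past _ hE m _ mstate h).
rewrite rhsE -IH//.
(* The ratio factor involves only the past, since [Gamma_(s+2)] is the first component of the
   state. *)
pose F (z : (R * (R * R * R)) * R) :=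
  ((z.1.1 `^ p * z.1.2.1.1 `^ (- p))%:E * h (z.1.2, z.2))%E.
pose f w := (G s.+1 w, state gamma s N w).
transitivity (\int[P]_w F (f w, E m w))%E.
  by apply: eq_integral => w _; rewrite stateS.
have mF : measurable_fun setT F.
  apply: emeasurable_funM.
    apply/measurable_EFinP; apply: measurable_funM.
      apply: (measurableT_comp (measurable_powR _)).
      exact: (measurableT_comp measurable_fst measurable_fst).
    apply: (measurableT_comp (measurable_powR _)).
    do 2 apply: (measurableT_comp measurable_fst).
    exact: (measurableT_comp measurable_snd measurable_fst).
  apply: (measurableT_comp mh); apply/measurable_fun_pairP; split => //=.
    exact: (measurableT_comp measurable_snd measurable_fst).
  exact: measurable_snd.
have mf : measurable_fun [set: pastType E m]
    (f : pastType E m -> R * (R * R * R)).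
  apply/measurable_fun_pairP; split => //=.
  by apply: measurable_past_Gamma; rewrite /m addSn ltnS (leq_trans _ (leq_addr _ _)).
transitivity (\int[P]_w \int[mu]_y (F (f w, y) * (e1 y)%:E))%E.
  apply: (ge0_integral_past _ hE m f mf F) => //.
  by move=> z; rewrite mule_ge0 ?lee_fin ?mulr_ge0 ?powR_ge0 ?h0.
apply: eq_integral => w _; rewrite /k -ge0_integralZl//.
- by apply: eq_integral => y _; rewrite /F/= /he/= muleA.
- exact: (measurableT_comp mhe (@pair1_measurable _ _ _ R _)).
- by rewrite lee_fin mulr_ge0// powR_ge0.
Qed.

End gamma_law.

(** * Moments of the ratio *)

Section ratio_moments.
Context {d : measure_display} {T : measurableType d} {R : realType}
  {P : probability T R} (E : nat -> {RV P >-> R}).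
Context (hE : iid_exponential1 E) (gamma : R) (gamma0 : 0 <= gamma).
Local Notation G := (Gamma (fun i => E i : T -> R)).

Lemma ae_RV_gt0 : {ae P, forall w, forall i, 0 < E i w}.
Proof.
apply: ae_foralln => i.
exists (E i @^-1` `]-oo, 0]); split; last by move=> w /= /negP; rewrite -leNgt in_itv.
  exact: measurable_funPTI.
have [_ hlaw] := hE; apply: (etrans (hlaw i `]-oo, 0]%classic (measurable_itv _))).
rewrite /exponential_prob.
(* Removes the endpoint 0, where the density is 1; it vanishes on the rest. *)
rewrite -integral_itv_bndo_bndc; last first.
  by apply/measurable_EFinP/measurable_funTS; exact: measurable_exponential_pdf.
by apply: integral0_eq => x /=; rewrite in_itv/= => x0; rewrite lt0_exponential_pdf.
Qed.

Lemma ae_Gamma_gt0 : {ae P, forall w, forall k, 0 < G k.+1 w}.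
Proof.
apply: filterS ae_RV_gt0 => w Ew k; elim: k => [|k IH]; first by rewrite /Gamma big_ord1.
by rewrite GammaS addr_gt0.
Qed.

(** With [N + 1] terms kept, [N = 0] gives almost surely the constant 1 from which [partial_moment]
    starts. *)
Definition truncated_ratio (s N : nat) (w : T) : R :=
  (\sum_(s.+1 <= k < s.+2 + N) G k w `^ (- gamma)) / G s.+1 w `^ (- gamma).

Lemma truncated_ratio_ge0 (s N : nat) (w : T) : 0 <= truncated_ratio s N w.
Proof.
by rewrite divr_ge0 ?powR_ge0// sumr_ge0// => k _; exact: powR_ge0.
Qed.

Lemma measurable_partial_sum (m n : nat) :
  measurable_fun setT (fun w => \sum_(m <= k < n) G k w `^ (- gamma)).
Proof.
apply: measurable_sum => k; apply: (measurableT_comp (measurable_powR _)).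
exact: measurable_Gamma.
Qed.

Lemma measurable_inv_powR (a : R) : measurable_fun setT (fun x : R => (x `^ a)^-1).
Proof. by under eq_fun do rewrite -powRN; exact: measurable_powR. Qed.

Lemma measurable_truncated_ratio (s N : nat) : measurable_fun setT (truncated_ratio s N).
Proof.
apply: measurable_funM; first exact: measurable_partial_sum.
exact: (measurableT_comp (measurable_inv_powR _) (measurable_Gamma _ _)).
Qed.

Lemma truncated_ratioS (s N : nat) (w : T) : (forall k, 0 < G k.+1 w) ->
  truncated_ratio s N.+1 w =
  1 + G s.+1 w `^ gamma * G s.+2 w `^ (- gamma) * truncated_ratio s.+1 N w.
Proof.
move=> G0; have p0 k := powR_gt0 (- gamma) (G0 k).
have -> : G s.+1 w `^ gamma = (G s.+1 w `^ (- gamma))^-1 by rewrite powRN invrK.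
rewrite /truncated_ratio addnS big_ltn; last by rewrite !addSn !ltnS leqW// leq_addr.
have := p0 s; have := p0 s.+1; rewrite !addSn.
move: (_ `^ _) (\sum_(_ <= _ < _) _) (_ `^ _) => b S a.
by rewrite !lt0r => /andP[b0 _] /andP[a0 _]; field; rewrite a0 b0.
Qed.

Let ge0l (l : nat) : 0 <= l%:R * gamma. Proof. by rewrite mulr_ge0. Qed.

Lemma truncated_ratio_indep (s N l : nat) :
  (\int[P]_w (G s.+1 w `^ (l%:R * gamma) * G s.+2 w `^ (- (l%:R * gamma)) *
      truncated_ratio s.+1 N w ^+ l)%:E =
   (s.+1%:R / (s.+1%:R + l%:R * gamma))%:E *
   \int[P]_w (truncated_ratio s.+1 N w ^+ l)%:E)%E.
Proof.
(* The absolute value makes [g] nonnegative everywhere; on actual states it changes nothing. *)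
pose g (z : R * R * R) := (`|z.1.2 / z.1.1 `^ (- gamma)| ^+ l)%:E.
have gE w : g (state E gamma s N w) = (truncated_ratio s.+1 N w ^+ l)%:E.
  by rewrite /g/= ger0_norm; last exact: (truncated_ratio_ge0 s.+1 N w).
have mg : measurable_fun setT g.
  apply/measurable_EFinP; apply: measurable_funX.
  apply: measurableT_comp => //; apply: measurable_funM.
    exact: (measurableT_comp measurable_snd measurable_fst).
  apply: (measurableT_comp (measurable_inv_powR _)).
  exact: (measurableT_comp measurable_fst measurable_fst).
have := state_ratio_indep E hE gamma (l%:R * gamma) s N g (ge0l l) mg.
under eq_integral do rewrite gE -EFinM.
under [in RHS]eq_integral do rewrite gE.
by apply => z; rewrite lee_fin exprn_ge0.
Qed.

(** The binomial expansion of [truncated_ratioS], integrated term by term with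
    [truncated_ratio_indep], is the recursion defining [partial_moment]. *)
Lemma truncated_ratio_moment (N k s : nat) :
  (\int[P]_w (truncated_ratio s N w ^+ k)%:E = (partial_moment gamma N k s)%:E)%E.
Proof.
elim: N k s => [|N IH] k s.
  transitivity (\int[P]_w (cst 1 w : \bar R))%E; last first.
    by rewrite integral_cst//= probability_setT mule1.
  apply: ae_eq_integral => //.
    apply/measurable_EFinP; apply: measurable_funX.
    exact: measurable_truncated_ratio.
  apply: filterS ae_Gamma_gt0 => w G0 _.
  by rewrite /truncated_ratio addn0 big_nat1 divff ?expr1n// gt_eqF// powR_gt0.
pose f (l : 'I_k.+1) w := ('C(k, l)%:R%:E *
  (G s.+1 w `^ (l%:R * gamma) * G s.+2 w `^ (- (l%:R * gamma)) *
      truncated_ratio s.+1 N w ^+ l)%:E)%E.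
have mr l : measurable_fun setT (fun w => (G s.+1 w `^ (l%:R * gamma) *
    G s.+2 w `^ (- (l%:R * gamma)) * truncated_ratio s.+1 N w ^+ l)%:E).
  apply/measurable_EFinP; apply: measurable_funM; last first.
    by apply: measurable_funX; exact: measurable_truncated_ratio.
  by apply: measurable_funM; apply: (measurableT_comp (measurable_powR _) (measurable_Gamma _ _)).
have r0 l w : (0 <= (G s.+1 w `^ (l%:R * gamma) * G s.+2 w `^ (- (l%:R * gamma)) *
    truncated_ratio s.+1 N w ^+ l)%:E)%E.
  by rewrite lee_fin !mulr_ge0 ?powR_ge0// exprn_ge0// truncated_ratio_ge0.
transitivity (\int[P]_w \sum_(l < k.+1) f l w)%E.
  apply: ae_eq_integral => //.
  - by apply/measurable_EFinP; apply: measurable_funX; exact: measurable_truncated_ratio.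
  - by apply: emeasurable_sum => l; apply: emeasurable_funM => //; exact: mr.
  apply: filterS ae_Gamma_gt0 => w G0 _.
  rewrite truncated_ratioS// addrC exprD1n /f sumEFin; congr EFin.
  apply: eq_bigr => l _; rewrite mulr_natl; congr (_ *+ _).
  rewrite !exprMn -!(powR_mulrn _ (powR_ge0 _ _)) -!powRrM.
  by rewrite mulNr ![gamma * _]mulrC.
rewrite ge0_integral_sum//; last 2 first.
- by move=> l; apply: emeasurable_funM => //; exact: mr.
- by move=> l w _; rewrite mule_ge0// lee_fin.
rewrite -sumEFin; apply: eq_bigr => l _.
by rewrite ge0_integralZl// truncated_ratio_indep IH -!EFinM.
Qed.

End ratio_moments.

(** The real [limn] takes a default value on divergence, so it is expressed through the extended
    limit [U], which is finite exactly where the sequence converges. *)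
Lemma measurable_limn_nondecreasing {d} {T : measurableType d} {R : realType}
    (u : nat -> T -> R) : (forall n, measurable_fun setT (u n)) ->
  (forall w, nondecreasing_seq (u ^~ w)) ->
  measurable_fun setT (fun w => limn (u ^~ w)).
Proof.
move=> mu ndu.
pose U w := limn (fun n => (u n w)%:E).
have Ucvg w : (u n w)%:E @[n --> \oo] --> U w.
  by apply: ereal_nondecreasing_is_cvgn => m n mn; rewrite lee_fin; exact: ndu.
have mU : measurable_fun setT U.
  apply: (emeasurable_fun_cvg (fun n w => (u n w)%:E)) => [n|w _]; last exact: Ucvg.
  exact/measurable_EFinP.
have uU n w : ((u n w)%:E <= U w)%E.
  rewrite /U (cvg_lim _ (ereal_nondecreasing_cvgn _))//.
    by apply: ereal_sup_ubound; exists n.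
  by move=> i j ij; rewrite lee_fin; exact: ndu.
have limE w : limn (u ^~ w) = if (U w < +oo)%E then fine (U w) else point.
  case: ifPn => [Uoo|]; last first.
    move=> /negP Uoo; apply: dvgP => ul; apply: Uoo.
    have : (u n w)%:E @[n --> \oo] --> (limn (u ^~ w))%:E.
      by apply: cvg_EFin => //; exact: nearW.
    by move=> /cvg_lim; rewrite -/(U w) => ->//; rewrite ltry.
  have Ufin : U w \is a fin_num.
    by rewrite fin_real// Uoo andbT (lt_le_trans _ (uU 0%N w)) ?ltNyr.
  apply/cvg_lim => //; apply: (@fine_cvg _ _ _ _ (fun n => (u n w)%:E)).
  by rewrite fineK//; exact: Ucvg.
rewrite (_ : (fun w => _) = fun w => if (U w < +oo)%E then fine (U w) else point).
  apply: measurable_fun_ifT => //.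
    exact: measurable_fun_lte.
  by apply: measurableT_comp => //; exact: fine_measurable.
by apply/funext => w.
Qed.

(** * Passage to the full series *)

Section moments.
Context {d : measure_display} {T : measurableType d} {R : realType}
  {P : probability T R} (E : nat -> {RV P >-> R}).
Context (hE : iid_exponential1 E) (gamma : R) (gamma1 : 1 < gamma).
Local Notation G := (Gamma (fun i => E i : T -> R)).
Local Notation tr := (truncated_ratio E gamma).

Let gamma0 : 0 <= gamma. Proof. by rewrite ltW// (lt_trans ltr01). Qed.

Lemma nondecreasing_partial_sum (m : nat) (w : T) :
  nondecreasing_seq (fun n => \sum_(m <= k < n) G k w `^ (- gamma)).
Proof.
apply/nondecreasing_seqP => n; have [mn|nm] := leqP m n.
  by rewrite big_nat_recr//= lerDl powR_ge0.
by rewrite !big_geq// ltnW.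
Qed.

Lemma nondecreasing_truncated_ratio (s : nat) (w : T) :
  nondecreasing_seq (fun N => tr s N w).
Proof.
move=> m n mn; rewrite ler_wpM2r ?invr_ge0 ?powR_ge0//.
by apply: nondecreasing_partial_sum; rewrite leq_add2l.
Qed.

Definition full_ratio (s : nat) (w : T) : R :=
  limn (fun n => \sum_(s.+1 <= k < n) G k w `^ (- gamma)) / G s.+1 w `^ (- gamma).

Lemma measurable_full_ratio (s : nat) : measurable_fun setT (full_ratio s).
Proof.
apply: measurable_funM.
  apply: measurable_limn_nondecreasing => [n|w].
    exact: measurable_partial_sum.
  exact: nondecreasing_partial_sum.
exact: (measurableT_comp (measurable_inv_powR _) (measurable_Gamma _ _)).
Qed.

(** Bounded powers of the truncated ratios bound the partial sums, so the series converges and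
    [limn] is its true sum. *)
Lemma full_ratio_cvg (s k : nat) (w : T) (B : R) : (0 < k)%N -> 0 < G s.+1 w ->
  (forall N, tr s N w ^+ k <= B) -> tr s N w @[N --> \oo] --> full_ratio s w.
Proof.
move=> k0 G0 trB; pose c := G s.+1 w `^ (- gamma).
have c0 : 0 < c by rewrite powR_gt0.
pose S n := \sum_(s.+1 <= j < n) G j w `^ (- gamma).
have Scvg : S n @[n --> \oo] --> limn S.
  apply: nondecreasing_is_cvgn; first exact: nondecreasing_partial_sum.
  (* A ratio [t] is either at most 1, or satisfies [t <= t^k <= B]. *)
  exists ((1 + B) * c) => _ [n _ <-].
  have Sn : S n <= S (s.+2 + n)%N.
    by apply: nondecreasing_partial_sum; rewrite leq_addl.
  rewrite (le_trans Sn)// -ler_pdivrMr// -[S _ / c]/(tr s n w).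
  have B0 : 0 <= B by rewrite (le_trans _ (trB 0%N))// exprn_ge0// truncated_ratio_ge0.
  have [t1|t1] := leP (tr s n w) 1; first by rewrite (le_trans t1)// lerDl.
  rewrite (le_trans _ (le_trans (trB n) _)) ?lerDr//.
  by rewrite ler_eXnr// ltW.
apply: cvgMl.
have := Scvg; rewrite -(cvg_shiftn s.+2) => h.
apply: cvg_trans h; apply: near_eq_cvg; apply: nearW => n /=.
by rewrite addnC.
Qed.

(** Monotone convergence gives the integral of the extended limit [phi]. Its finiteness makes [phi]
    finite almost everywhere, which yields the almost sure convergence of the series and identifies
    [phi] with the power of [full_ratio]. *)
Lemma full_ratio_moment (s k : nat) : (0 < k)%N ->
  (\int[P]_w (full_ratio s w ^+ k)%:E = (moment gamma k s)%:E)%E.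
Proof.
move=> k0.
pose phi w := limn (fun N => (tr s N w ^+ k)%:E).
have mtr N : measurable_fun setT (fun w => (tr s N w ^+ k)%:E).
  by apply/measurable_EFinP; apply: measurable_funX; exact: measurable_truncated_ratio.
have tr0 N w : (0 <= (tr s N w ^+ k)%:E)%E.
  by rewrite lee_fin exprn_ge0// truncated_ratio_ge0.
have ndtr w : nondecreasing_seq (fun N => (tr s N w ^+ k)%:E).
  move=> m n mn; rewrite lee_fin lerXn2r ?nnegrE ?truncated_ratio_ge0//.
  exact: nondecreasing_truncated_ratio.
have phiE : (\int[P]_w phi w = (moment gamma k s)%:E)%E.
  rewrite monotone_convergence//.
  apply/cvg_lim => //.
  under eq_fun do rewrite (truncated_ratio_moment _ hE)//.
  by apply: cvg_EFin; [exact: nearW|exact: partial_moment_cvg].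
have phi0 w : (0 <= phi w)%E by apply: lime_ge; [exact: ereal_nondecreasing_is_cvgn|exact: nearW].
have mphi : measurable_fun setT phi.
  apply: (emeasurable_fun_cvg (fun N w => (tr s N w ^+ k)%:E)) => // w _.
  exact: ereal_nondecreasing_is_cvgn.
rewrite -phiE; apply: ae_eq_integral => //.
  by apply/measurable_EFinP; apply: measurable_funX; exact: measurable_full_ratio.
have iphi : P.-integrable setT phi.
  apply/integrableP; split => //.
  by under eq_integral do rewrite gee0_abs//; rewrite phiE ltry.
have := integrable_ae measurableT iphi.
apply: filterS2 (ae_Gamma_gt0 _ hE) => w G0 /(_ I) phifin _.
have trphi N : tr s N w ^+ k <= fine (phi w).
  rewrite -lee_fin fineK// /phi (cvg_lim _ (ereal_nondecreasing_cvgn _))//.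
  by apply: ereal_sup_ubound; exists N.
apply/esym/cvg_lim => //; apply: cvg_EFin; first exact: nearW.
have tr_cvg := full_ratio_cvg s k w _ k0 (G0 s) trphi.
exact: (cvg_comp (fun N => tr s N w) (fun x : R => x ^+ k) tr_cvg
  (@exprn_continuous _ k (full_ratio s w))).
Qed.

End moments.

Theorem corollary3p1 (d : measure_display) (T : measurableType d)
  (R : realType) (P : probability T R) (E : nat -> {RV P >-> R})
  (hE : iid_exponential1 E)
  (alpha gamma : R) (halpha0 : 0 < alpha) (halpha1 : alpha < 1)
  (hgamma : gamma = 1 / alpha) (s k : nat) (hk : (1 <= k)%N) :
  ('E_P[(fun w => ratioR (fun i => E i) alpha s w ^+ k)%R] =
   (1 + \sum_(1 <= i < k.+1) 'C(k, i)%:R *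
          \sum_(1 <= j < i.+1) ((s + j)%N`!%:R / s`!%:R) * Ccoef i j gamma)%:E)%E.
Proof.
have gamma1 : 1 < gamma by rewrite hgamma ltr_pdivlMr// mul1r.
rewrite -momentE -(full_ratio_moment E hE gamma gamma1 s k hk) unlock.
by rewrite /ratioR -hgamma.
Qed.
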